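(* Let $G=(V,E)$ be a finite directed graph (possibly cyclic) and consider a finite functional causal model on $G$. The following statements are equivalent: (i) the model is probabilistically Markovian, i.e. its distribution $P(\cdot)_G$ is defined and for all $x=\{x_v\in\mathcal X_v\}_{v\in V}$, $P(x)_G=\prod_{v\in V}P^{(v)}(x_v\mid x_{\mathrm{Pa}(v)})_G$, where $P^{(v)}(x_v\mid x_{\mathrm{Pa}(v)})_G=\sum_{u_v\in\mathcal U_v}p^v(u_v)\,\delta_{x_v,f^v(x_{\mathrm{Pa}(v)},u_v)}$; (ii) the model is averagely uniquely solvable, i.e. its average number of solutions is $\overline N=1$; (iii) for every choice of teleportation graph $G_{\mathrm t}\in\mathcal G_{\mathrm{tele}}(G)$, with split-vertex set $S$, used in the definition of the post-selection success probability, $P_{\mathrm{succ}}=\prod_{v\in S}p_{\mathrm{tele}}^{(v)}$, where $p_{\mathrm{tele}}^{(v)}$ is the success probability of the classical post-selected teleportation protocol implemented for the split vertex $v$.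
   Context: Graphs. A directed graph $G=(V,E)$ has a finite vertex set $V$ and edges $E\subseteq V\times V$, $(v,w)$ being an edge from $v$ to $w$. $\mathrm{Pa}(v)=\{w:(w,v)\in E\}$, $\mathrm{Ch}(v)=\{w:(v,w)\in E\}$, $\mathrm{out}(v)=\{(v,w)\in E\}$. Finite functional causal model (fCM) on $G$. To each $v\in V$ assign: a random variable $X_v$ with values $x_v$ in a non-empty finite set $\mathcal X_v$; an error variable $U_v$ with values $u_v$ in a finite set $\mathcal U_v$ with probability distribution $p^v$ on $\mathcal U_v$; a function $f^v:\prod_{w\in \mathrm{Pa}(v)}\mathcal X_w\times\mathcal U_v\to\mathcal X_v$. If $G$ is acyclic, its distribution is $P_{\mathrm{acyc}}(x)_G=\sum_u\prod_{v\in V}p^v(u_v)\,\delta_{x_v,f^v(x_{\mathrm{Pa}(v)},u_v)}$ for $x=\{x_v\}_{v\in V}$, the sum being over all $u=\{u_v\in\mathcal U_v\}_{v\in V}$. Number of solutions. For $u=\{u_v\in\mathcal U_v\}_{v\in V}$, $N(u)=\sum_{x}\prod_{v\in V}\delta_{f^v(x_{\mathrm{Pa}(v)},u_v),x_v}$ (sum over all $x=\{x_v\in\mathcal X_v\}_{v\in V}$). The average number of solutions is $\overline N=\sum_u N(u)\prod_{v\in V}p^v(u_v)$. Classical post-selected teleportation protocol on a finite set $\mathcal X_A=\mathcal X_C$: a finite set $\mathcal X_B$, a function $g:\mathcal X_A\times\mathcal X_B\times\mathcal X_C\to\{0,1\}$ and probability distributions $q_B$ on $\mathcal X_B$, $q_C$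 on $\mathcal X_C$ such that for all probability distributions $p^A$ on $\mathcal X_A$ and all $c\in\mathcal X_C$, $\sum_{a,b}p^A(a)\,\delta_{g(a,b,c),1}\,q_B(b)\,q_C(c)=p_{\mathrm{tele}}\,p^A(c)$, where $p_{\mathrm{tele}}\in(0,1]$ (independent of $p^A$) is the success probability. Teleportation graphs. The family $\mathcal G_{\mathrm{tele}}(G)$ consists of all graphs $G_{\mathrm{t}}$ obtained thus: choose $S\subseteq V$ (''split vertices'') such that $(V,E')$ with $E'=E\setminus\bigcup_{v\in S}\mathrm{out}(v)$ is acyclic. The vertices of $G_{\mathrm t}$ are $V\cup\{R_v\}_{v\in S}\cup\{T_v\}_{v\in S}$ with new vertices $R_v$ (pre-selection) and $T_v$ (post-selection). The edges are $E'\cup\{(v,T_v),(R_v,T_v)\}_{v\in S}\cup\{(R_v,w): v\in S,\ w\in\mathrm{Ch}(v)\text{ in }G\}$. All such $G_{\mathrm t}$ are acyclic. Teleportation models. Given an fCM on $G$ and $G_{\mathrm t}\in\mathcal G_{\mathrm{tele}}(G)$, a classical teleportation model on $G_{\mathrm t}$ is an fCM in which: for each $v\in S$, $T_v$ takes values $t_v\in\{0,1\}$, $R_v$ takes values $r_v\in\mathcal X_v$ and equals its error variable, and the function $f^{T_v}$ with the error distributions $p^{T_v},p^{R_v}$ form a classical post-selected teleportation protocol ($g=f^{T_v}$ with arguments the value of $v$, the error of $T_v$, and the value of $R_v$; $q_B=p^{T_v}$, $q_C=p^{R_v}$), with success probability $p_{\mathrm{tele}}^{(v)}$; every $w\in V$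 keeps the same sets, error variable and function as in the fCM on $G$, where $r_v$ replaces $x_v$ as an input for each $v\in S\cap \mathrm{Pa}(w)$ (parents in $G$). Probabilities in $G$. The post-selection success probability of a teleportation model is $P_{\mathrm{succ}}=P_{\mathrm{acyc}}(\{t_v=1\}_{v\in S})_{G_{\mathrm t}}$. If $P_{\mathrm{succ}}>0$ the distribution of the fCM on $G$ is $P(x)_G:=P_{\mathrm{acyc}}(x\mid\{t_v=1\}_{v\in S})_{G_{\mathrm t}}$ for $x=\{x_v\in\mathcal X_v\}_{v\in V}$ (values of $R_v$ marginalized). If $P_{\mathrm{succ}}=0$ the model is inconsistent and $P(\cdot)_G$ is undefined. Neither consistency nor $P(\cdot)_G$ depends on the choice of teleportation graph and teleportation model. *)

(* Defs.v *)
From HB Require Import structures.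
From mathcomp Require Import all_boot all_order all_algebra.

Set Implicit Arguments.
Unset Strict Implicit.
Unset Printing Implicit Defensive.
Import Order.TTheory GRing.Theory Num.Theory.
Local Open Scope ring_scope.

Record pdist (R : realFieldType) (T : finType) := PDist {
  pmf :> T -> R;
  pmf_ge0 : forall t, 0 <= pmf t;
  pmf_sum1 : \sum_t pmf t = 1 }.

(** A directed graph on [V] is a relation [E : rel V]; [E v w] means that
    [(v, w)] is an edge, so self-loops are allowed. *)

Definition acyclic (V : finType) (E : rel V) : Prop :=
  forall c : seq V, cycle E c -> c = [::].

Definition Pa (V : finType) (E : rel V) (v : V) : finType := {w : V | E w v}.

Record fcm (R : realFieldType) (V : finType) (E : rel V) := FCM {
  Xs : V -> finType;
  Xs_nonempty : forall v, inhabited (Xs v);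
  Us : V -> finType;
  perr : forall v, pdist R (Us v);
  func : forall v, {dffun forall w : Pa E v, Xs (val w)} -> Us v -> Xs v }.

Definition assignment (R : realFieldType) (V : finType) (E : rel V)
  (M : fcm R E) : finType := {dffun forall v : V, Xs M v}.

Definition errors (R : realFieldType) (V : finType) (E : rel V)
  (M : fcm R E) : finType := {dffun forall v : V, Us M v}.

Definition xPa (R : realFieldType) (V : finType) (E : rel V) (M : fcm R E)
    (v : V) (x : assignment M) : {dffun forall w : Pa E v, Xs M (val w)} :=
  [ffun w : Pa E v => x (val w)].

(** Meaningful as a probability distribution only when [E] is acyclic. *)
Definition Pacyc (R : realFieldType) (V : finType) (E : rel V) (M : fcm R E)
    (x : assignment M) : R :=
  \sum_(u : errors M)
    \prod_(v : V) (perr M v (u v) * (x v == func (xPa v x) (u v))%:R).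

Definition Pr (R : realFieldType) (V : finType) (E : rel V) (M : fcm R E)
    (A : pred (assignment M)) : R :=
  \sum_(x : assignment M | A x) Pacyc x.

Definition condPr (R : realFieldType) (V : finType) (E : rel V) (M : fcm R E)
    (A B : pred (assignment M)) : R :=
  Pr (predI A B) / Pr B.

Definition Nsol (R : realFieldType) (V : finType) (E : rel V) (M : fcm R E)
    (u : errors M) : nat :=
  (\sum_(x : assignment M) \prod_(v : V) (func (xPa v x) (u v) == x v))%N.

Definition avgNsol (R : realFieldType) (V : finType) (E : rel V)
    (M : fcm R E) : R :=
  \sum_(u : errors M) (Nsol u)%:R * \prod_(v : V) perr M v (u v).

Definition Pker (R : realFieldType) (V : finType) (E : rel V) (M : fcm R E)
    (v : V) (x : assignment M) : R :=
  \sum_(uv : Us M v) perr M v uv * (x v == func (xPa v x) uv)%:R.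

(** The values 0 and 1 of the post-selection are [false] and [true]. *)
Record tele_protocol (R : realFieldType) (A : finType) := TeleProtocol {
  tele_B : finType;
  tele_g : A -> tele_B -> A -> bool;
  tele_qB : pdist R tele_B;
  tele_qC : pdist R A;
  p_tele : R;
  p_tele_in01 : 0 < p_tele <= 1;
  tele_spec : forall (pA : pdist R A) (c : A),
    \sum_(a : A) \sum_(b : tele_B)
       pA a * (tele_g a b c)%:R * tele_qB b * tele_qC c = p_tele * pA c }.

Definition cut_edges (V : finType) (E : rel V) (S : {set V}) : rel V :=
  fun v w => E v w && (v \notin S).

Definition split_vertex (V : finType) (S : {set V}) : finType :=
  {v : V | v \in S}.

Definition tele_vertex (V : finType) (S : {set V}) : finType :=
  (V + (split_vertex S + split_vertex S))%type.

(** [OV v], [RV s], [TV s] are the original vertex v, the pre-selection vertex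
    R_s and the post-selection vertex T_s. *)
Notation OV v := (inl v).
Notation RV s := (inr (inl s)).
Notation TV s := (inr (inr s)).

Definition tele_edges (V : finType) (E : rel V) (S : {set V}) :
    rel (tele_vertex S) :=
  fun a b => match a, b with
  | OV v, OV w => cut_edges E S v w
  | OV v, TV s => v == val s
  | RV s, TV s' => s == s'
  | RV s, OV w => E (val s) w
  | _, _ => false
  end.
Arguments tele_edges {V} E S.

(** A choice of teleportation graph and of a protocol for each split vertex. *)
Record tele_choice (R : realFieldType) (V : finType) (E : rel V)
    (M : fcm R E) := TeleChoice {
  split_set : {set V};
  split_acyclic : acyclic (cut_edges E split_set);
  proto : forall s : split_vertex split_set, tele_protocol R (Xs M (val s)) }.

(** Such a choice always exists: split every vertex, and post-select on the two
    values being equal, with a uniform pre-selection. *)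
Lemma tele_choice_inhabited (R : realFieldType) (V : finType) (E : rel V)
  (M : fcm R E) : inhabited (tele_choice M).
Proof.
have sum_cst (T : finType) (c : R) : \sum_(i : T) c = c *+ #|T|.
  by rewrite -sumr_const; apply: eq_bigl.
have proto0 v : tele_protocol R (Xs M v).
  have n_gt0 : (0 < #|Xs M v|)%N.
    by case: (Xs_nonempty M v) => x; apply/card_gt0P; exists x.
  have nR_gt0 : 0 < #|Xs M v|%:R :> R by rewrite ltr0n.
  have qB1 : \sum_(i : unit) (1 : R) = 1 by rewrite sum_cst card_unit.
  have qC1 : \sum_(i : Xs M v) #|Xs M v|%:R^-1 = 1 :> R.
    by rewrite sum_cst -[LHS]mulr_natl mulfV ?gt_eqF.
  have qC0 : 0 <= #|Xs M v|%:R^-1 :> R by rewrite invr_ge0 ltW.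
  apply: (@TeleProtocol R (Xs M v) unit (fun a _ c => a == c)
            (PDist (fun=> ler01) qB1) (PDist (fun=> qC0) qC1) #|Xs M v|%:R^-1).
    by rewrite invr_gt0 nR_gt0 invf_le1 // ler1n.
  move=> pA c; rewrite (bigD1 c) //= [X in _ + X]big1 => [|a /negPf a_c].
    by rewrite addr0 sum_cst card_unit eqxx !mulr1 mulrC.
  by rewrite big1 // => b _; rewrite a_c mulr0 !mul0r.
have acyc : acyclic (cut_edges E [set: V]).
  by case=> [|x [|y p]] //; rewrite /cycle /= /cut_edges in_setT andbF.
by exists; apply: TeleChoice acyc (fun s => proto0 (val s)).
Qed.

Section TeleModel.
Context (R : realFieldType) (V : finType) (E : rel V) (M : fcm R E).
Context (t : tele_choice M).
Local Notation S := (split_set t).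
Local Notation Et := (tele_edges E S).

Definition tele_Xs (a : tele_vertex S) : finType :=
  match a with OV v => Xs M v | RV s => Xs M (val s) | TV _ => bool end.

Definition tele_Us (a : tele_vertex S) : finType :=
  match a with
  | OV v => Us M v
  | RV s => Xs M (val s)
  | TV s => tele_B (proto s)
  end.

Definition tele_perr (a : tele_vertex S) : pdist R (tele_Us a) :=
  match a with
  | OV v => perr M v
  | RV s => tele_qC (proto s)
  | TV s => tele_qB (proto s)
  end.

Lemma tele_Xs_nonempty a : inhabited (tele_Xs a).
Proof.
case: a => [v|[s|s]] /=; [exact: Xs_nonempty | exact: Xs_nonempty | ].
exact: (inhabits true).
Qed.

(** The parents of [OV v] are [RV w] for the split parents [w] of [v] in [E] and
    [OV w] for the others: these are the inputs of [func M v], where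
    the value of [RV w] replaces that of a split parent [w]. *)
Definition tele_inputs (v : V)
    (y : {dffun forall a : Pa Et (OV v), tele_Xs (val a)}) :
    {dffun forall w : Pa E v, Xs M (val w)} :=
  [ffun w : Pa E v =>
    match boolP (val w \in S) return Xs M (val w) with
    | AltTrue wS =>
        y (exist (fun a => Et a (OV v)) (RV (exist _ (val w) wS)) (valP w))
    | AltFalse wNS =>
        y (exist (fun a => Et a (OV v)) (OV (val w))
             (introT andP (conj (valP w) wNS)))
    end].

Definition tele_func (a : tele_vertex S) :
    {dffun forall b : Pa Et a, tele_Xs (val b)} -> tele_Us a -> tele_Xs a :=
  match a with
  | OV v => fun y u => func (tele_inputs y) u
  | RV s => fun _ u => u
  | TV s => fun y u =>
      tele_g (y (exist (fun b => Et b (TV s)) (OV (val s)) (eqxx (val s))))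
             u
             (y (exist (fun b => Et b (TV s)) (RV s) (eqxx s)))
  end.

Definition tele_fcm : fcm R Et := FCM tele_Xs_nonempty tele_perr tele_func.

Definition postselected : pred (assignment tele_fcm) :=
  fun z => [forall s : split_vertex S, (z (TV s) : bool)].

Definition original_values (x : assignment M) : pred (assignment tele_fcm) :=
  fun z => [forall v : V, (z (OV v) : Xs M v) == x v].

Definition Psucc : R := Pr postselected.

(** The distribution P(x)_G computed with [t]; it is undefined, and the value
    below is junk, unless [0 < Psucc]. *)
Definition Pcyc (x : assignment M) : R :=
  condPr (original_values x) postselected.

Definition prob_markovian : Prop :=
  0 < Psucc /\ forall x : assignment M, Pcyc x = \prod_(v : V) Pker v x.

End TeleModel.

Definition avg_uniquely_solvable (R : realFieldType) (V : finType)
  (E : rel V) (M : fcm R E) : Prop := avgNsol M = 1.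

Definition tele_success_factorizes (R : realFieldType) (V : finType)
    (E : rel V) (M : fcm R E) : Prop :=
  forall t : tele_choice M,
    Psucc t = \prod_(s : split_vertex (split_set t)) p_tele (proto s).

(* Main.v *)
(** Let [K x] be the product of the kernels [Pker v x]; exchanging sums and
    products, the average number of solutions is the sum of [K x] over all [x].
    Applied to point masses, the protocol identity says that the pair
    ([R_s], [T_s]) with [T_s = 1] contributes the factor
    [p_tele * (x_s == r_s)].  Hence [{OV-values = x, all t_s = 1}] carries only
    one outcome of nonzero weight, the one with [r_s = x_s], and its probability
    is [(\prod_s p_tele^(s)) * K x].  So [Psucc] is [\prod_s p_tele^(s)] times
    the average number of solutions N, and [P(x)_G = K x / N]. *)
Require Import Defs.
From mathcomp Require Import all_boot all_order all_algebra.

Set Implicit Arguments.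
Unset Strict Implicit.
Unset Printing Implicit Defensive.
Import Order.TTheory GRing.Theory Num.Theory.
Local Open Scope ring_scope.

(** Passing to [fprod T] turns dependent functions into plain ones valued in tagged pairs, to which
    [bigA_distr_big_dep] applies. *)
Lemma prod_sum_dffun (R : comNzRingType) (I : finType) (T : I -> finType)
    (F : forall i, T i -> R) :
  \prod_i \sum_(j : T i) F i j =
  \sum_(f : {dffun forall i, T i}) \prod_i F i (f i).
Proof.
rewrite (reindex (@dffun_of_fprod I T)) /=; last first.
  by apply: onW_bij; exact: dffun_of_fprod_bij.
transitivity (\sum_(t : fprod T) \prod_(i in I) [ffun j => F i j] (t i)).
  under eq_bigr do under eq_bigr do rewrite -[F _ _](ffunE (F _)).
  under eq_bigr => i _ do
    rewrite (big_tag (fun i j => [ffun k => F i k] j) i).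
  by rewrite bigA_distr_big_dep -big_fprod.
apply: eq_bigr => f _; apply: eq_bigr => i _.
by rewrite /dffun_of_fprod !ffunE.
Qed.

Section Model.
Context (R : realFieldType) (V : finType) (E : rel V) (M : fcm R E).

(** Each factor involves a single [u v], so the sum over errors factors. This serves both for [E],
    possibly cyclic, and for the teleportation graph. *)
Lemma PacycE (x : assignment M) : Pacyc x = \prod_v Pker v x.
Proof. by rewrite /Pacyc /Pker prod_sum_dffun. Qed.

Lemma avgNsolE : avgNsol M = \sum_(x : assignment M) \prod_v Pker v x.
Proof.
under [RHS]eq_bigr do rewrite -PacycE /Pacyc.
rewrite exchange_big /=; apply: eq_bigr => u _.
rewrite /Nsol natr_sum mulr_suml; apply: eq_bigr => x _.
rewrite natr_prod -big_split /=; apply: eq_bigr => v _.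
by rewrite mulrC eq_sym.
Qed.

End Model.

Section Protocol.
Context (R : realFieldType) (A : finType) (p : tele_protocol R A).

(** [tele_spec] at the point mass at [a]. *)
Lemma tele_spec_point (a c : A) :
  tele_qC p c * (\sum_(b : tele_B p) tele_qB p b * (true == tele_g a b c)%:R) =
  p_tele p * (a == c)%:R.
Proof.
have pt0 i : 0 <= (a == i)%:R :> R by rewrite ler0n.
have pt1 : \sum_i (a == i)%:R = 1 :> R.
  by rewrite (bigD1 a) //= eqxx big1 ?addr0 // => i /negPf; rewrite eq_sym => ->.
rewrite -[RHS](tele_spec p (PDist pt0 pt1) c) /= (bigD1 a) //= eqxx.
rewrite [X in _ + X]big1 ?addr0 => [|i]; last first.
  by rewrite eq_sym => /negPf ia; rewrite big1 // => b _; rewrite ia !mul0r.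
rewrite mulr_sumr; apply: eq_bigr => b _.
by rewrite mul1r mulrC eq_sym eqb_id [_%:R * _]mulrC.
Qed.

End Protocol.

Section Tele.
Context (R : realFieldType) (V : finType) (E : rel V) (M : fcm R E).
Context (t : tele_choice M).
Local Notation S := (split_set t).
Local Notation K := (tele_fcm t).

(** The only post-selected outcome over [x] whose weight can be nonzero. *)
Definition tele_lift_val (x : assignment M) (a : tele_vertex S) : Xs K a :=
  match a with OV v => x v | RV s => x (val s) | TV _ => true end.

Definition tele_lift (x : assignment M) : assignment K :=
  [ffun a => tele_lift_val x a].

Lemma Pker_orig (x : assignment M) (v : V) :
  Pker (OV v) (tele_lift x) = Pker v x.
Proof.
rewrite /Pker; apply: eq_bigr => u _.
rewrite ffunE /=; congr (_ * (_ == func _ _)%:R).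
apply/ffunP => w; rewrite /tele_inputs !ffunE.
(* The value read is that of [RV w] or of [OV w]; the lift gives both the value [x (val w)]. *)
by case: {-}_ / (boolP (val w \in S)) => wS; rewrite !ffunE.
Qed.

(** [R_s] equals its error, so its kernel is [tele_qC] at [r_s]; the kernel of [T_s] at 1 is the sum
    over [b] in [tele_spec_point]. *)
Lemma Pker_pre_post (z : assignment K) (s : split_vertex S) : z (TV s) = true ->
  Pker (RV s) z * Pker (TV s) z =
  p_tele (proto s) * ((z (OV (val s)) : Xs M (val s)) == z (RV s))%:R.
Proof.
move=> zT; rewrite -tele_spec_point /Pker; congr (_ * _).
  rewrite /= (bigD1 (z (RV s))) //= eqxx mulr1 big1 ?addr0 // => u.
  by rewrite eq_sym => /negPf; rewrite /= => ->; rewrite mulr0.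
by apply: eq_bigr => u _; rewrite zT /= !ffunE.
Qed.

Lemma Pacyc_mismatch (z : assignment K) (s : split_vertex S) :
  z (TV s) = true -> (z (OV (val s)) : Xs M (val s)) != z (RV s) ->
  Pacyc z = 0.
Proof.
move=> zT /negPf zs; have := Pker_pre_post zT; rewrite zs mulr0 => pre_post0.
by rewrite PacycE !big_sumType /= -big_split /= [X in _ * X](bigD1 s) //= pre_post0
  mul0r mulr0.
Qed.

Lemma Pr_orig_post (x : assignment M) :
  Pr (predI (original_values x) (@postselected _ _ _ _ t)) =
  (\prod_(s : split_vertex S) p_tele (proto s)) * \prod_v Pker v x.
Proof.
rewrite /Pr (bigD1 (tele_lift x)) /=; last first.
  by apply/andP; split; apply/forallP => i; rewrite ffunE //= eqxx.
rewrite [X in _ + X]big1 ?addr0 => [|z /andP[/andP[/forallP zx /forallP zT] zN]].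
  rewrite PacycE !big_sumType /= -big_split /= mulrC; congr (_ * _).
    apply: eq_bigr => s _.
    by rewrite Pker_pre_post !ffunE //= eqxx mulr1.
  by apply: eq_bigr => v _; exact: Pker_orig.
(* Either some [r_s] differs from [x_s] and the weight vanishes, or [z] agrees everywhere with the
   lift, which is excluded. *)
have [s zs|zR] := pickP (fun s : split_vertex S =>
    (z (OV (val s)) : Xs M (val s)) != z (RV s)).
  exact: Pacyc_mismatch (zT s) zs.
case/eqP: zN; apply/ffunP => -[v|[s|s]]; rewrite ffunE /=.
- exact/eqP/zx.
- by move/negbT: (zR s); rewrite negbK => /eqP <-; exact/eqP/zx.
- exact: zT.
Qed.

Lemma PsuccE :
  Psucc t = (\prod_(s : split_vertex S) p_tele (proto s)) * avgNsol M.
Proof.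
rewrite avgNsolE mulr_sumr /Psucc /Pr.
(* Post-selected outcomes are grouped by their original values; each block is the event of
   [Pr_orig_post]. *)
rewrite (partition_big (fun z : assignment K =>
  [ffun v => z (OV v) : Xs M v] : assignment M) predT) //=.
apply: eq_bigr => x _; rewrite -Pr_orig_post /Pr; apply: eq_bigl => z /=.
rewrite andbC; congr (_ && _); apply/eqP/forallP => [<- v|zx].
  by rewrite ffunE.
by apply/ffunP => v; rewrite ffunE; apply/eqP/zx.
Qed.

Lemma prod_p_tele_gt0 : 0 < \prod_(s : split_vertex S) p_tele (proto s).
Proof. by apply: prodr_gt0 => s _; case/andP: (p_tele_in01 (proto s)). Qed.

(** The positive product of the [p_tele] cancels. If [avgNsol M] is 0, both sides are 0, as division
    by zero yields 0. *)
Lemma PcycE (x : assignment M) : Pcyc t x = (\prod_v Pker v x) / avgNsol M.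
Proof.
rewrite /Pcyc /condPr Pr_orig_post -/(Psucc t) PsuccE invfM mulrACA.
by rewrite mulfV ?mul1r // gt_eqF // prod_p_tele_gt0.
Qed.

End Tele.

Theorem corollary3 (R : realFieldType) (V : finType) (E : rel V)
    (M : fcm R E) (t : tele_choice M) :
  [<-> prob_markovian t; avg_uniquely_solvable M; tele_success_factorizes M].
Proof.
rewrite /avg_uniquely_solvable; tfae.
- case=> Psucc_gt0 PcycK.
  have N_gt0 : 0 < avgNsol M.
    by move: Psucc_gt0; rewrite PsuccE pmulr_rgt0 // prod_p_tele_gt0.
  (* The total mass of [Pcyc t] is N by the Markov property and N / N = 1 by [PcycE]. *)
  transitivity (\sum_(x : assignment M) Pcyc t x).
    by rewrite avgNsolE; apply: eq_bigr => x _; rewrite PcycK.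
  under eq_bigr do rewrite PcycE.
  by rewrite -mulr_suml -avgNsolE mulfV // gt_eqF.
- by move=> N1 t'; rewrite PsuccE N1 mulr1.
(* At [t], comparison with [PsuccE] gives N = 1 after cancelling the positive product. *)
- move=> /(_ t) PsuccP.
  have N1 : avgNsol M = 1.
    apply: (mulfI (lt0r_neq0 (prod_p_tele_gt0 t))).
    by rewrite -PsuccE PsuccP mulr1.
  split=> [|x]; first by rewrite PsuccP prod_p_tele_gt0.
  by rewrite PcycE N1 divr1.
Qed.
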